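(* Suppose either (a) $c+1\geq a\geq c>0$ and $\{g_n\}_{n=0}^{\infty}$ is an arbitrary nonnegative sequence, or (b) $a>c+1>1$ and $\{g_n\}_{n=0}^{\infty}$ is a nonnegative log-concave sequence without internal zeros. Let $$g_{a,c}(\mu;x)=\sum_{n=0}^{\infty}g_n\frac{\Gamma(a+n+\mu)}{\Gamma(c+n+\mu)}\frac{x^n}{n!},\qquad \psi_{a,c}(\mu,\nu;x)=g_{a,c}(\mu;x)g_{a,c}(\nu;x)-g_{a,c}(0;x)g_{a,c}(\mu+\nu;x).$$ Then $\mu\mapsto g_{a,c}(\mu;x)$ is discrete Wright log-concave on $[0,\infty)$ for each fixed $x>0$. Moreover, the family $\{g_{a,c}(\mu;x)\}_{\mu\geq0}$ is discrete $q$-log-concave, i.e. $\psi_{a,c}(\mu,\nu;x)$ has nonnegative power series coefficients (in powers of $x$) for all $\nu\in\mathbb{N}$ and $\mu\geq\nu-1$, so that for such $\mu,\nu$ the function $x\mapsto\psi_{a,c}(\mu,\nu;x)$ is absolutely monotonic and multiplicatively convex on $(0,\infty)$.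
   Context: $\mathbb{N}$ is the set of positive integers. A nonnegative sequence $\{g_n\}_{n\ge0}$ is log-concave if $g_n^2\ge g_{n-1}g_{n+1}$ for all $n\ge1$; it has no internal zeros if $g_N=0$ implies that either $g_{N+i}=0$ for all $i\ge0$ or $g_{N-i}=0$ for $i=0,1,\dots,N$; log-concave sequences are also assumed non-trivial (not identically zero). A function $F:[0,\infty)\to[0,\infty)$ is discrete Wright log-concave if $F(\mu+\alpha)F(\mu+\beta)\ge F(\mu)F(\mu+\alpha+\beta)$ for all $\alpha\in\mathbb{N}$ and all $\mu,\beta\ge0$. A family $\{f(\mu;x)\}_{\mu\ge0}$ of formal power series in $x$ whose coefficients are nonnegative continuous functions of $\mu$ is discrete $q$-log-concave if $f(\mu+\alpha;x)f(\mu+\beta;x)-f(\mu;x)f(\mu+\alpha+\beta;x)$ has nonnegative coefficients at all powers of $x$ for all $\alpha\in\mathbb{N}$, $\beta\ge\alpha-1$ and $\mu\ge0$. A function is absolutely monotonic on an interval if it and all its derivatives are nonnegative there. A nonnegative function $\phi$ is multiplicatively convex if $\phi(x^{\lambda}y^{1-\lambda})\le\phi(x)^{\lambda}\phi(y)^{1-\lambda}$ for all $x,y$ in the interval and $\lambda\in[0,1]$. Power series are understood as formal; assertions about values at fixed $x$, or about functions of $x$ on $(0,\infty)$, are understood for those $x>0$ in the interval of convergence of the series. *)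

(* Defs.v *)
(* MathComp-Analysis. *)
From HB Require Import structures.
From mathcomp Require Export all_boot all_order all_algebra.
From mathcomp Require Export all_classical all_reals all_analysis.
Export Order.TTheory GRing.Theory Num.Theory.
Export numFieldNormedType.Exports.

Set Implicit Arguments.
Unset Strict Implicit.
Unset Printing Implicit Defensive.

Local Open Scope classical_set_scope.
Local Open Scope ring_scope.

(* Euler's integral; meaningful for z > 0, the only case used. *)
Definition Gamma (R : realType) (z : R) : R :=
  \int[@lebesgue_measure R]_(t in `]0, +oo[) (t `^ (z - 1) * expR (- t)).

Definition log_concave (R : realType) (g : nat -> R) : Prop :=
  [/\ forall n, 0 <= g n,
      exists n, g n != 0 &
      forall n, (1 <= n)%N -> g n.-1 * g n.+1 <= g n ^+ 2].

Definition no_internal_zeros (R : realType) (g : nat -> R) : Prop :=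
  forall N, g N = 0 ->
    (forall i, g (N + i)%N = 0) \/ (forall i, (i <= N)%N -> g (N - i)%N = 0).

(* A formal power series is the sequence of its coefficients, so that
   [pseries f x] is the sequence of its partial sums at x. *)
Definition psum (R : realType) (f : nat -> R) (x : R) : R := limn (pseries f x).

Definition pmul (R : realType) (f h : nat -> R) (n : nat) : R :=
  \sum_(k < n.+1) f k * h (n - k)%N.

(* The positive x in the interval of convergence of every series (f m), m in M;
   the right end point belongs to it when the series converge there. *)
Definition pos_conv (R : realType) (f : R -> nat -> R) (M : set R) : set R :=
  [set x | 0 < x /\ forall m, M m -> cvgn (pseries (f m) x)].

Definition discrete_wright_log_concave (R : realType) (F : R -> R) : Prop :=
  (forall mu, 0 <= mu -> 0 <= F mu) /\
  forall (alpha : nat) (mu beta : R), (0 < alpha)%N -> 0 <= mu -> 0 <= beta ->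
    F mu * F (mu + alpha%:R + beta) <= F (mu + alpha%:R) * F (mu + beta).

Definition discrete_q_log_concave (R : realType) (f : R -> nat -> R) : Prop :=
  [/\ forall mu n, 0 <= mu -> 0 <= f mu n,
      forall n, {within `[0, +oo[, continuous (fun mu => f mu n)} &
      forall (alpha : nat) (mu beta : R),
        (0 < alpha)%N -> alpha%:R - 1 <= beta -> 0 <= mu ->
        forall n, 0 <= pmul (f (mu + alpha%:R)) (f (mu + beta)) n
                       - pmul (f mu) (f (mu + alpha%:R + beta)) n].

(* At an end point belonging to the interval, where the derivatives need not
   exist, absolute monotonicity means nonnegativity and continuity, as usual. *)
Definition absolutely_monotonic (R : realType) (I : set R) (f : R -> R) : Prop :=
  [/\ forall x, I x -> 0 <= f x,
      {within I, continuous f} &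
      forall n x, I° x -> derivable (derive1n n f) x 1 /\ 0 <= derive1n n f x].

Definition multiplicatively_convex (R : realType) (I : set R) (f : R -> R)
    : Prop :=
  (forall x, I x -> 0 <= f x) /\
  forall x y lambda, I x -> I y -> 0 <= lambda <= 1 ->
    f (x `^ lambda * y `^ (1 - lambda))
      <= f x `^ lambda * f y `^ (1 - lambda).

Definition gcoef (R : realType) (g : nat -> R) (a c mu : R) (n : nat) : R :=
  g n * (Gamma (a + n%:R + mu) / Gamma (c + n%:R + mu)) / n`!%:R.

Definition psi_coef (R : realType) (g : nat -> R) (a c mu nu : R) (n : nat) : R :=
  pmul (gcoef g a c mu) (gcoef g a c nu) n
  - pmul (gcoef g a c 0) (gcoef g a c (mu + nu)) n.

Definition psi (R : realType) (g : nat -> R) (a c mu nu x : R) : R :=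
  psum (gcoef g a c mu) x * psum (gcoef g a c nu) x
  - psum (gcoef g a c 0) x * psum (gcoef g a c (mu + nu)) x.

(* Main.v *)
Require Import Defs.
From mathcomp Require Import measurable_realfun.
From mathcomp Require Import ring lra zify.

(** Write h(t) = Gamma(a+t)/Gamma(c+t), so that the coefficients in question are
    g_n h(n+mu)/n!. Of the Gamma function only three facts are used: it is
    positive and continuous on the positive half-line, and
    Gamma(z+1) = z Gamma(z), which for h reads (c+t) h(t+1) = (a+t) h(t).

    Coefficients, nu = 1. Put H(t) = h(t)/(c+t). By the recurrence of h, the m-th
    coefficient of psi(beta, 1) is (a-c) times the sum over k <= m of
      g_k g_(m-k) E_k,
      E_k = (beta + k - (m-k)) H(k+beta) H(m-k) / (k! (m-k)!).
    The weight g_k g_(m-k) is symmetric under k -> m-k, so E_k can be replaced by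
    T_k = E_k + E_(m-k). The ratio H(t+1)/H(t) = (a+t)/(c+1+t) is monotone in t.
    If a <= c+1 it increases, H is log-convex along integer steps, and every T_k
    is nonnegative ([cross_term_pair_ge0]), whatever the nonnegative weights are.
    If a >= c+1 it decreases, H is log-concave, and T_k changes sign at most
    once, from - to +, as k runs from 0 to m/2 ([cross_term_pair_sign]).
    Log-concavity of g makes the weights increase over the same range
    ([log_concave_mul_le]), so the weighted sum is nonnegative as soon as the
    unweighted one is ([sumr_ge0_sign_change]).

    The unweighted sum is the m-th coefficient of beta W U + x (W' U - W U'),
    where W and U are the power series with coefficients H(k+beta)/k! and H(k)/k!,
    constant multiples of confluent hypergeometric series. Their differential
    equations give a first order recurrence in m with nonnegative data for these
    coefficients, hence their nonnegativity ([wronskian_coef_ge0]).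

    General nu and Wright log-concavity. For mu >= nu - 1, induction on nu
    applies the case nu = 1 with beta = mu + nu and then shifts both parameters
    by one ([ratio_coef_q_log_concave]). Summing the case nu = 1 at a fixed x
    shows that mu -> f(mu+1)/f(mu) is nonincreasing, which is Wright
    log-concavity ([wright_of_unit_step]).

    Functions of x. By the Cauchy product, psi is the sum of a power series with
    nonnegative coefficients on an interval starting at 0. Such a sum is
    continuous up to the end point because its tails are monotone in x, has
    nonnegative derivatives of all orders inside
    ([psum_absolutely_monotonic]), and is multiplicatively convex by Hoelder's
    inequality ([psum_multiplicatively_convex]). *)

Set Implicit Arguments.
Unset Strict Implicit.
Unset Printing Implicit Defensive.

Local Open Scope classical_set_scope.
Local Open Scope ring_scope.

(** * Sign changes and log-concave weights *)

(** Where a weight separates the negative terms from the positive ones, it can be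
    replaced by a constant C between the two groups without increasing any
    term, and the sum with constant weight is C times a nonnegative number. *)
Lemma sumr_ge0_sign_change (R : realType) (I : finType) (w T : I -> R) :
    (forall i, 0 <= w i) -> 0 <= \sum_i T i ->
    (forall i j, T i < 0 -> 0 < T j -> w i <= w j) ->
  0 <= \sum_i w i * T i.
Proof.
move=> w0 sT wT.
(* The largest weight of a negative term, 0 when there is none. *)
pose C := \big[Num.max/0]_(i | T i < 0) w i.
have C0 : 0 <= C.
  by apply: (big_ind (fun x => 0 <= x)) => // x y x0 y0; rewrite le_max x0.
have wC i : C * T i <= w i * T i.
  have [Ti|Ti|->] := ltgtP (T i) 0; last by rewrite !mulr0.
  - rewrite ler_nM2r //; apply: (@le_bigmax_cond _ R I 0 i (fun i => T i < 0) w) => //.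
  - rewrite ler_pM2r //; apply: bigmax_le => // j Tj; exact: wT.
apply: (@le_trans _ _ (C * \sum_i T i)); first exact: mulr_ge0.
by rewrite mulr_sumr; apply: ler_sum.
Qed.

(** Two indices with a given sum give a larger product when they are closer
    together. The absence of internal zeros makes g positive between any two
    indices of its support, so that the ratios g_(n+1)/g_n are defined there and
    nonincreasing; without it a gap in the support would break the claim. *)
Lemma log_concave_mul_le (R : realType) (g : nat -> R) (i j l m : nat) :
    log_concave g -> no_internal_zeros g ->
    (i <= j)%N -> (j <= l)%N -> (i + m = j + l)%N ->
  g i * g m <= g j * g l.
Proof.
move=> [g0 _ glc] gz ij jl e.
have [->|gi] := eqVneq (g i) 0; first by rewrite mul0r mulr_ge0.
have [->|gm] := eqVneq (g m) 0; first by rewrite mulr0 mulr_ge0.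
have gpos n : (i <= n)%N -> (n <= m)%N -> 0 < g n.
  move=> ni nm; rewrite lt_neqAle g0 andbT eq_sym.
  apply/negP => /eqP /gz [] H.
  - by move: gm; rewrite -(subnKC nm) H eqxx.
  - have := H (n - i)%N (leq_subr _ _); rewrite subKn // => gi'.
    by move: gi; rewrite gi' eqxx.
have ratio n p : (i <= n)%N -> (n + p < m)%N ->
    g n * g (n + p).+1 <= g n.+1 * g (n + p)%N.
  move=> ni; elim: p => [|p IH] npm; first by rewrite addn0 mulrC lexx.
  rewrite addnS; rewrite addnS in npm.
  have a1 := gpos (n + p)%N ltac:(lia) ltac:(lia).
  have a2 := gpos (n + p).+1 ltac:(lia) ltac:(lia).
  have := glc (n + p).+1 isT; rewrite /= => H1.
  have {}IH := IH ltac:(lia).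
  rewrite -(ler_pM2l a1).
  apply: (@le_trans _ _ (g n * g (n + p).+1 ^+ 2)).
    by rewrite mulrCA ler_wpM2l.
  rewrite expr2 mulrA [leRHS]mulrCA [leRHS]mulrA.
  by rewrite ler_pM2r.
have main d l' : (i + d <= l')%N -> (l' + d <= m)%N ->
    g i * g (l' + d)%N <= g (i + d)%N * g l'.
  elim: d => [|d IH] in l' *; first by rewrite !addn0.
  move=> il lm; have {}IH := IH l'.+1 ltac:(lia) ltac:(lia).
  rewrite addnS -addSn; apply: (le_trans IH).
  have := ratio (i + d)%N (l' - (i + d))%N ltac:(lia) ltac:(lia).
  by rewrite subnKC ?addnS //; lia.
have := main (j - i)%N l ltac:(lia) ltac:(lia).
by rewrite subnKC // (_ : (l + (j - i))%N = m) //; lia.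
Qed.

(** Everything about the Gamma function that the coefficient inequalities need:
    Gamma(a+t)/Gamma(c+t) satisfies this, and the property is stable under the
    shift of t and under the division that turns c into c + 1. *)
Definition gamma_ratio_rec (R : realType) (a c : R) (h : R -> R) : Prop :=
  (forall t, 0 <= t -> 0 < h t) /\
  (forall t, 0 <= t -> (c + t) * h (t + 1) = (a + t) * h t).

Lemma gamma_ratio_rec_shift (R : realType) (a c s : R) (h : R -> R) : 0 <= s ->
  gamma_ratio_rec a c h ->
  gamma_ratio_rec (a + s) (c + s) (fun t => h (t + s)).
Proof.
move=> s0 [h0 hr]; split=> t t0; first by apply: h0; lra.
have := hr (t + s) ltac:(lra).
by rewrite addrAC !(addrAC _ s) -!addrA.
Qed.

Lemma gamma_ratio_rec_div (R : realType) (a c : R) (h : R -> R) : 0 < c ->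
  gamma_ratio_rec a c h ->
  gamma_ratio_rec a (c + 1) (fun t => h t / (c + t)).
Proof.
move=> c0 [h0 hr]; split=> t t0; first by rewrite divr_gt0 ?h0 //; lra.
have := hr t t0 => E.
have c1 : c + t != 0 by rewrite gt_eqF //; lra.
have c2 : c + (t + 1) != 0 by rewrite gt_eqF //; lra.
apply: (mulfI c1); rewrite !mulrA mulrAC.
rewrite [LHS](_ : _ = (c + t) * h (t + 1)); last by field; rewrite c2.
by rewrite E; field.
Qed.

(** The hypothesis on t and s compares the growth factors (a+t)/(b+t) and
    (a+s)/(b+s), whose difference has the sign of (b - a) (s - t); stated with
    products it serves the case a <= b with t <= s and the case b <= a with
    s <= t at once. *)
Lemma gamma_ratio_rec_step_le (R : realType) (a b x y t s : R) (H : R -> R) :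
    0 < b -> gamma_ratio_rec a b H -> 0 <= t -> 0 <= s ->
    (b - a) * t <= (b - a) * s -> 0 <= y ->
    x * H t <= y * H s -> x * H (t + 1) <= y * H (s + 1).
Proof.
move=> b0 [H0 Hr] t0 s0 ts y0 xy.
have e1 := Hr _ t0; have e2 := Hr _ s0.
have p1 := H0 _ t0; have p2 := H0 _ s0.
have p3 := H0 (t + 1) ltac:(lra); have p4 := H0 (s + 1) ltac:(lra).
have bt : 0 < b + t by lra.
have bs : 0 < b + s by lra.
have a1 : 0 < a + t by rewrite -(pmulr_lgt0 _ p1) -e1 mulr_gt0.
rewrite -(ler_pM2l bt) -(ler_pM2l bs).
rewrite (_ : _ * (_ * (x * _)) = (b + s) * x * ((b + t) * H (t + 1))); last by ring.
rewrite (_ : _ * (_ * (y * _)) = (b + t) * y * ((b + s) * H (s + 1))); last by ring.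
rewrite e1 e2.
apply: (@le_trans _ _ ((b + s) * (a + t) * (y * H s))).
  rewrite (_ : _ * x * _ = (b + s) * (a + t) * (x * H t)); last by ring.
  by rewrite ler_pM2l // mulr_gt0.
rewrite (_ : _ * y * _ = (b + t) * (a + s) * (y * H s)); last by ring.
have p5 : 0 <= y * H s by rewrite mulr_ge0 // ltW.
rewrite ler_wpM2r // -subr_ge0.
by rewrite (_ : _ - _ = (b - a) * s - (b - a) * t); [rewrite subr_ge0 | ring].
Qed.

Lemma gamma_ratio_rec_log_convex (R : realType) (a b t s : R) (H : R -> R) (n : nat) :
    0 < b -> gamma_ratio_rec a b H -> a <= b -> 0 <= t -> t <= s ->
  H (t + n%:R) * H s <= H t * H (s + n%:R).
Proof.
move=> b0 HR ab t0 ts; elim: n => [|n IH]; first by rewrite !addr0.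
have n0 : (0 : R) <= n%:R by [].
rewrite -natr1 !addrA [X in X <= _]mulrC.
apply: (gamma_ratio_rec_step_le (a := a) (b := b)) => //; try lra; try nra.
by rewrite ltW // HR.1.
Qed.

Lemma gamma_ratio_rec_log_concave (R : realType) (a b t s : R) (H : R -> R) (n : nat) :
    0 < b -> gamma_ratio_rec a b H -> b <= a -> 0 <= t -> t <= s ->
  H t * H (s + n%:R) <= H (t + n%:R) * H s.
Proof.
move=> b0 HR ab t0 ts; elim: n => [|n IH]; first by rewrite !addr0.
have n0 : (0 : R) <= n%:R by [].
rewrite -natr1 !addrA [X in _ <= X]mulrC.
apply: (gamma_ratio_rec_step_le (a := a) (b := b)) => //; try lra; try nra.
by rewrite ltW // HR.1 //; lra.
Qed.

(** * The cross terms *)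

(** The sum, call it W_m, is the m-th coefficient of beta w u + x (w' u - w u')
    for the generating functions w and u. With p = k and q = m - k,
      (m + beta + c) (beta + p - q)
        = p (p + beta + c) - q (q + c) + beta (p + beta + c),
    and the recurrences of w and u lower the index by one in the first two
    terms, which leaves
      (m + beta + c) W_m = W_(m-1) + beta sum_k (k + beta + c) w_k u_(m-k).
    Nonnegativity follows by induction on m. *)
Lemma wronskian_coef_ge0 (R : realType) (a c beta : R) (w u : nat -> R) (m : nat) :
    0 < c -> 0 <= beta -> (forall n, 0 <= w n) -> (forall n, 0 <= u n) ->
    (forall n, n.+1%:R * (c + 1 + beta + n%:R) * w n.+1 = (a + beta + n%:R) * w n) ->
    (forall n, n.+1%:R * (c + 1 + n%:R) * u n.+1 = (a + n%:R) * u n) ->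
  0 <= \sum_(k < m.+1) (beta + k%:R - (m - k)%:R) * (w k * u (m - k)%N).
Proof.
move=> c0 be0 w0 u0 wr ur.
elim: m => [|m IH].
  by rewrite big_ord1 subr0 addr0 !mulr_ge0.
have pos : 0 < m.+1%:R + beta + c :> R by rewrite ltr_wpDl // addr_ge0.
rewrite -(pmulr_rge0 _ pos).
pose A k : R := k%:R * (k%:R + beta + c) * (w k * u (m.+1 - k)%N).
pose B k : R := (m.+1 - k)%:R * ((m.+1 - k)%:R + c) * (w k * u (m.+1 - k)%N).
pose S k : R := beta * (k%:R + beta + c) * (w k * u (m.+1 - k)%N).
have split_term (k : 'I_m.+2) :
    (m.+1%:R + beta + c) * ((beta + k%:R - (m.+1 - k)%:R) * (w k * u (m.+1 - k)%N))
    = A k - B k + S k.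
  have -> : m.+1%:R = k%:R + (m.+1 - k)%:R :> R.
    by rewrite -natrD subnKC // -ltnS.
  by rewrite /A /B /S; ring.
rewrite mulr_sumr (eq_bigr _ (fun k _ => split_term k)) big_split sumrB /=.
rewrite addr_ge0 //; last first.
  by apply: sumr_ge0 => k _; rewrite /S !(mulr_ge0, addr_ge0) // ltW.
have -> : \sum_(k < m.+2) A k
    = \sum_(k < m.+1) (a + beta + k%:R) * (w k * u (m - k)%N).
  rewrite big_ord_recl {1}/A !mul0r add0r; apply: eq_bigr => k _.
  rewrite /A lift0 subSS !mulrA -wr -natr1; ring.
have -> : \sum_(k < m.+2) B k
    = \sum_(k < m.+1) (a + (m - k)%:R) * (w k * u (m - k)%N).
  rewrite big_ord_recr {2}/B /= subnn !mul0r addr0; apply: eq_bigr => k _.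
  rewrite /B subSn -1?ltnS // [RHS]mulrCA -ur -natr1; ring.
rewrite -sumrB; apply: le_trans IH _; apply: ler_sum => k _.
rewrite [X in _ <= X](_ : _ = (beta + k%:R - (m - k)%:R) * (w k * u (m - k)%N)) //.
ring.
Qed.

(** The k-th summand of the m-th coefficient of psi(beta, 1), up to the factor
    (a - c) g_k g_(m-k). *)
Definition cross_term (R : realType) (H : R -> R) (beta : R) (m k : nat) : R :=
  (beta + k%:R - (m - k)%:R) * (H (k%:R + beta) * H (m - k)%:R)
  / (k`!%:R * (m - k)`!%:R).

Lemma sum_cross_term_ge0 (R : realType) (a c beta : R) (H : R -> R) (m : nat) :
    0 < c -> 0 <= beta -> gamma_ratio_rec a (c + 1) H ->
  0 <= \sum_(k < m.+1) cross_term H beta m k.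
Proof.
move=> c0 be0 [H0 Hr].
have fne n : n`!%:R != 0 :> R by rewrite pnatr_eq0 -lt0n fact_gt0.
have fne1 n : n%:R + 1 != 0 :> R by rewrite natr1.
have := @wronskian_coef_ge0 R a c beta (fun n => H (n%:R + beta) / n`!%:R)
  (fun n => H n%:R / n`!%:R) m c0 be0.
have -> : \sum_(k < m.+1) cross_term H beta m k =
    \sum_(k < m.+1) (beta + k%:R - (m - k)%:R) *
       (H (k%:R + beta) / k`!%:R * (H (m - k)%:R / (m - k)`!%:R)).
  by apply: eq_bigr => k _; rewrite /cross_term; field; rewrite !fne.
apply.
- by move=> n; rewrite divr_ge0 // ltW // H0 // addr_ge0.
- by move=> n; rewrite divr_ge0 // ltW // H0.
- move=> n; have E := Hr (n%:R + beta) ltac:(by rewrite addr_ge0).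
  rewrite factS natrM -natr1 (addrAC n%:R 1 beta).
  rewrite [LHS](_ : _ = (c + 1 + (n%:R + beta)) * H (n%:R + beta + 1) / n`!%:R).
    by rewrite E; field; exact: fne.
  by field; rewrite fne fne1.
- move=> n; have E := Hr n%:R ltac:(by []).
  rewrite factS natrM -natr1.
  rewrite [LHS](_ : _ = (c + 1 + n%:R) * H (n%:R + 1) / n`!%:R).
    by rewrite E; field; exact: fne.
  by field; rewrite fne fne1.
Qed.

Lemma cross_term_pair (R : realType) (H : R -> R) (beta : R) (m k : nat) :
    (k <= m - k)%N ->
  let d : R := (m - k)%:R - k%:R in
  cross_term H beta m k + cross_term H beta m (m - k) =
  ((beta - d) * (H (k%:R + beta) * H (m - k)%:R)
   + (beta + d) * (H ((m - k)%:R + beta) * H k%:R)) / (k`!%:R * (m - k)`!%:R).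
Proof.
move=> km d.
have fne n : n`!%:R != 0 :> R by rewrite pnatr_eq0 -lt0n fact_gt0.
rewrite /cross_term subKn; last by lia.
by rewrite /d; field; rewrite !fne.
Qed.

(** With d = m - 2k, X = H(k+beta) H(m-k) and Y = H(m-k+beta) H(k), log-convexity
    gives X <= Y, so (beta - d) X + (beta + d) Y is at least 2 beta X. *)
Lemma cross_term_pair_ge0 (R : realType) (a c beta : R) (H : R -> R) (m k : nat) :
    0 < c -> a <= c + 1 -> 0 <= beta -> gamma_ratio_rec a (c + 1) H ->
    (k <= m - k)%N ->
  0 <= cross_term H beta m k + cross_term H beta m (m - k).
Proof.
move=> c0 ac be0 HR km; rewrite cross_term_pair //.
apply: divr_ge0 => //.
have c10 : 0 < c + 1 by lra.
have := @gamma_ratio_rec_log_convex R a (c + 1) k%:R (k%:R + beta) H (m - k - k)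
  c10 HR ac ltac:(by []) ltac:(lra).
rewrite addrAC -natrD subnKC //.
set X := H (k%:R + beta) * _; set Y := H (_ + beta) * _.
rewrite mulrC -/X mulrC -/Y => XY.
have X0 : 0 <= X by rewrite mulr_ge0 // ltW // HR.1 // addr_ge0.
have d0 : 0 <= (m - k)%:R - k%:R :> R by rewrite subr_ge0 ler_nat.
set d := _ - _ in d0 *; nra.
Qed.

(** The bracket (beta - d) X + (beta + d) Y of [cross_term_pair], with d = m - 2k,
    is nonnegative when d <= beta, and otherwise exactly when
    Y/X >= (d - beta)/(d + beta). When k grows towards m/2, d decreases, so the
    right-hand side decreases, while log-concavity of H makes Y/X increase. *)
Lemma cross_term_pair_sign (R : realType) (a c beta : R) (H : R -> R) (m k j : nat) :
    0 < c -> c + 1 <= a -> 0 <= beta -> gamma_ratio_rec a (c + 1) H ->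
    (k <= j)%N -> (j <= m - j)%N ->
    0 <= cross_term H beta m k + cross_term H beta m (m - k) ->
  0 <= cross_term H beta m j + cross_term H beta m (m - j).
Proof.
move=> c0 ac be0 HR kj jm.
have c10 : 0 < c + 1 by lra.
rewrite !cross_term_pair //; last by lia.
have F n p : 0 < n`!%:R * p`!%:R :> R by rewrite mulr_gt0 // ltr0n fact_gt0.
rewrite !pmulr_lge0 ?invr_gt0 //.
have lc1 := @gamma_ratio_rec_log_concave R a (c + 1) k%:R (k%:R + beta) H (j - k)
  c10 HR ac ltac:(by []) ltac:(lra).
have lc2 := @gamma_ratio_rec_log_concave R a (c + 1)
  (m - j)%:R ((m - j)%:R + beta) H (j - k)
  c10 HR ac ltac:(by []) ltac:(lra).
rewrite addrAC -natrD subnKC // in lc1.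
rewrite addrAC -natrD (_ : (m - j + (j - k))%N = (m - k)%N) in lc2; last by lia.
have dd : (m - j)%:R - j%:R <= (m - k)%:R - k%:R :> R.
  by apply: lerB; rewrite ler_nat; lia.
have d0 : 0 <= (m - j)%:R - j%:R :> R by rewrite subr_ge0 ler_nat.
have P n : 0 < H (n%:R + beta) by rewrite HR.1 // addr_ge0.
have Q n : 0 < H n%:R by rewrite HR.1.
move: (P k) (P j) (P (m - k)%N) (P (m - j)%N) (Q k) (Q j) (Q (m - k)%N) (Q (m - j)%N).
move: dd d0 lc1 lc2.
set d := (m - k)%:R - _; set d' := (m - j)%:R - _.
set x1 := H (k%:R + _); set x2 := H (j%:R + _).
set x3 := H ((m - k)%:R + _); set x4 := H ((m - j)%:R + _).
set y1 := H k%:R; set y2 := H j%:R; set y3 := H (m - k)%:R; set y4 := H (m - j)%:R.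
move=> dd d0 lc1 lc2 p1 p2 p3 p4 q1 q2 q3 q4 S.
(* Y/X for k is at most Y'/X' for j, where X = x1 * y3, Y = x3 * y1,
   X' = x2 * y4 and Y' = x4 * y2. *)
have YX : (x3 * y1) * (x2 * y4) <= (x1 * y3) * (x4 * y2).
  rewrite (_ : _ * _ * _ = (y1 * x2) * (y4 * x3)); last by ring.
  rewrite [leRHS](_ : _ = (y2 * x1) * (y3 * x4)); last by ring.
  by apply: ler_pM => //; rewrite mulr_ge0 // ltW.
move: S YX; have : 0 < x1 * y3 by rewrite mulr_gt0.
have : 0 < x2 * y4 by rewrite mulr_gt0.
have : 0 < x3 * y1 by rewrite mulr_gt0.
have : 0 < x4 * y2 by rewrite mulr_gt0.
move: (x1 * y3) (x2 * y4) (x3 * y1) (x4 * y2) => X X' Y Y' Y'0 Y0 X'0 X0 S YX.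
have [bd|bd] := lerP d' beta; first by rewrite addr_ge0 // mulr_ge0 //; lra.
have S1 : (d - beta) * X <= (beta + d) * Y by lra.
have S2 : (d - beta) * X' <= (beta + d) * Y'.
  rewrite -(ler_pM2l X0); apply: (@le_trans _ _ ((beta + d) * Y * X')).
    by rewrite mulrCA mulrA ler_pM2r // (mulrC X).
  by rewrite -mulrA [leRHS]mulrCA ler_pM2l //; lra.
suff : (d' - beta) * X' <= (beta + d') * Y' by lra.
have bd0 : 0 < beta + d by lra.
(* (d - beta)/(d + beta) is increasing in d. *)
rewrite -(ler_pM2l bd0); apply: (@le_trans _ _ ((beta + d') * ((d - beta) * X'))).
  by rewrite !mulrA ler_pM2r //; nra.
by rewrite [leRHS]mulrCA ler_pM2l //; lra.
Qed.

(** * Coefficientwise log-concavity *)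

Definition admissible (R : realType) (a c : R) (g : nat -> R) : Prop :=
  [/\ a <= c + 1, c <= a, 0 < c & forall n, 0 <= g n] \/
  [/\ c + 1 < a, 1 < c + 1, log_concave g & no_internal_zeros g].

(** Folding the sum at its middle replaces [cross_term] by the sum of the two
    terms k and m - k, whose sign is controlled by the two pair lemmas. *)
Lemma weighted_cross_term_ge0 (R : realType) (a c beta : R) (g : nat -> R)
    (H : R -> R) (m : nat) :
    admissible a c g -> 0 <= beta -> gamma_ratio_rec a (c + 1) H ->
  0 <= \sum_(k < m.+1) g k * g (m - k)%N * cross_term H beta m k.
Proof.
move=> hyp be0 HR.
pose G k := g k * g (m - k)%N.
pose T k := cross_term H beta m k + cross_term H beta m (m - k).
have revG k : (k <= m)%N -> G (m - k)%N = G k.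
  by move=> km; rewrite /G subKn // mulrC.
have revT k : (k <= m)%N -> T (m - k)%N = T k.
  by move=> km; rewrite /T subKn // addrC.
have rev_sum (F : nat -> R) : \sum_(k < m.+1) F (m - k)%N = \sum_(k < m.+1) F k.
  by rewrite [RHS](reindex_inj rev_ord_inj).
rewrite -(pmulr_rge0 _ (ltr0n R 2)).
have -> : 2%:R * \sum_(k < m.+1) G k * cross_term H beta m k
    = \sum_(k < m.+1) G k * T k.
  have /= rs := rev_sum (fun k => G k * cross_term H beta m k).
  rewrite mulr2n mulrDl mul1r -{2}rs -big_split /=.
  apply: eq_bigr => k _; rewrite revG ?mulrDr //.
  by rewrite -ltnS.
(* Weights and folded terms depend only on the smaller of k and m - k. *)
have fold_half k : (k <= m)%N ->
    exists k', [/\ (k' <= m - k')%N, G k' = G k & T k' = T k].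
  move=> km; have [?|?] := leqP k (m - k)%N; first by exists k.
  by exists (m - k)%N; rewrite revG // revT //; split => //; lia.
case: hyp => [[ac ca c0 g0]|[ac c1 glc gz]].
  apply: sumr_ge0 => k _.
  have [k' [kk <- <-]] := fold_half k ltac:(by rewrite -ltnS).
  by rewrite mulr_ge0 ?mulr_ge0 //; apply: (cross_term_pair_ge0 (a := a) (c := c)).
have c0 : 0 < c by lra.
have g0 : forall n, 0 <= g n by case: glc.
apply: (sumr_ge0_sign_change (w := fun k : 'I_m.+1 => G k) (T := fun k => T k))
  => [i||i j Ti Tj]; first by rewrite mulr_ge0.
- rewrite big_split /=.
  have /= -> := rev_sum (cross_term H beta m).
  by rewrite addr_ge0 //; apply: (sum_cross_term_ge0 (a := a) (c := c)).
have [i' [im eG eT]] := fold_half i ltac:(by rewrite -ltnS).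
have [j' [jm eG' eT']] := fold_half j ltac:(by rewrite -ltnS).
rewrite -eG -eG'; rewrite -eT in Ti; rewrite -eT' in Tj.
have [ij|ji] := leqP i' j'.
  by apply: log_concave_mul_le => //; lia.
have := cross_term_pair_sign c0 (ltW ac) be0 HR (ltnW ji) im (ltW Tj).
by rewrite leNgt; rewrite -/(T i') Ti.
Qed.

Definition ratio_coef (R : realType) (g : nat -> R) (h : R -> R) (mu : R)
    (n : nat) : R :=
  g n * h (n%:R + mu) / n`!%:R.

Lemma pmulC (R : realType) (f h : nat -> R) n : pmul f h n = pmul h f n.
Proof.
rewrite /pmul (reindex_inj rev_ord_inj); apply: eq_bigr => k _ /=.
have kn : (k <= n)%N by rewrite -ltnS.
by rewrite subSS (subKn kn) mulrC.
Qed.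

(** The case nu = 1. Since h(t) = (c + t) H(t) and h(t+1) = (a + t) H(t), each
    difference of products of values of h is (a - c) times a product of values
    of H with the linear factor beta + k - (m - k). *)
Lemma ratio_coef_step (R : realType) (a c beta : R) (g : nat -> R)
    (h : R -> R) (m : nat) :
    admissible a c g -> 0 <= beta -> gamma_ratio_rec a c h ->
  pmul (ratio_coef g h 0) (ratio_coef g h (beta + 1)) m
  <= pmul (ratio_coef g h 1) (ratio_coef g h beta) m.
Proof.
move=> hyp be0 hR.
have c0 : 0 < c by case: hyp => -[] *; lra.
have ca : c <= a by case: hyp => -[] *; lra.
have HR := gamma_ratio_rec_div c0 hR; set H := (fun t => _) in HR.
have fne n : n`!%:R != 0 :> R by rewrite pnatr_eq0 -lt0n fact_gt0.
have hE t : 0 <= t -> h t = (c + t) * H t.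
  by move=> t0; rewrite /H mulrC divfK // gt_eqF //; lra.
have hE1 t : 0 <= t -> h (t + 1) = (a + t) * H t.
  move=> t0; have := hR.2 t t0; have ct : c + t != 0 by rewrite gt_eqF //; lra.
  by move=> E; apply: (mulfI ct); rewrite E /H; field.
rewrite -subr_ge0 pmulC [X in _ - X]pmulC /pmul -sumrB.
rewrite (eq_bigr (fun k : 'I_m.+1 =>
    (a - c) * (g k * g (m - k)%N * cross_term H beta m k))); last first.
  move=> k _; rewrite /ratio_coef /cross_term addr0 !addrA.
  rewrite hE1 // hE1 ?addr_ge0 // hE ?addr_ge0 // hE //.
  by field; rewrite !fne.
rewrite -mulr_sumr mulr_ge0 ?subr_ge0 //.
exact: (weighted_cross_term_ge0 m hyp be0 HR).
Qed.

Lemma admissible_shift (R : realType) (a c s : R) (g : nat -> R) : 0 <= s ->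
  admissible a c g -> admissible (a + s) (c + s) g.
Proof.
move=> s0 [[]*|[]*]; [left|right]; split => //; lra.
Qed.

Lemma ratio_coef_shift (R : realType) (g : nat -> R) (h : R -> R) (s mu : R) :
  ratio_coef g (fun t => h (t + s)) mu = ratio_coef g h (mu + s).
Proof. by apply/funext => n; rewrite /ratio_coef addrA. Qed.

(** Going from nu to nu + 1, the step with beta = mu + nu turns
    f(0) f(mu + nu + 1) into f(1) f(mu + nu); after a shift by 1 this is the
    product f(0) f((mu - 1) + nu) for the parameters a + 1 and c + 1. The bound
    mu >= nu - 1 is what survives the repeated subtraction of 1 from mu. *)
Lemma ratio_coef_q_log_concave (R : realType) (a c mu : R) (g : nat -> R)
    (h : R -> R) (nu m : nat) :
    admissible a c g -> gamma_ratio_rec a c h -> nu%:R - 1 <= mu ->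
  pmul (ratio_coef g h 0) (ratio_coef g h (mu + nu%:R)) m
  <= pmul (ratio_coef g h nu%:R) (ratio_coef g h mu) m.
Proof.
elim: nu => [|nu IH] in a c mu h *; first by rewrite addr0.
move=> hyp hR; rewrite -natr1 addrK => numu.
have n0 : 0 <= nu%:R :> R by [].
have := ratio_coef_step m hyp (_ : 0 <= mu + nu%:R) hR.
rewrite addrA => /(_ (addr_ge0 (le_trans n0 numu) n0)) /le_trans; apply.
have := IH (a + 1) (c + 1) (mu - 1) (fun t => h (t + 1))
  (admissible_shift ler01 hyp) (gamma_ratio_rec_shift ler01 hR).
rewrite !ratio_coef_shift add0r addrAC subrK.
by apply; lra.
Qed.

Lemma ratio_coef_q_log_concave_shift (R : realType) (a c s mu : R) (g : nat -> R)
    (h : R -> R) (nu m : nat) :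
    admissible a c g -> gamma_ratio_rec a c h -> 0 <= s -> nu%:R - 1 <= mu ->
  pmul (ratio_coef g h s) (ratio_coef g h (s + nu%:R + mu)) m
  <= pmul (ratio_coef g h (s + nu%:R)) (ratio_coef g h (s + mu)) m.
Proof.
move=> hyp hR s0 numu.
have := ratio_coef_q_log_concave m (admissible_shift s0 hyp)
  (gamma_ratio_rec_shift s0 hR) numu.
by rewrite !ratio_coef_shift add0r (addrC mu) ![_ + s]addrC addrA.
Qed.

(** * The Gamma function *)

Section GammaFacts.
Context {R : realType}.
Implicit Types (z t u v s : R).
Local Notation mu := (@lebesgue_measure R).

(** A bound for t^s that is uniform in s between u and v and valid both near 0
    and near infinity; it dominates the Gamma integrands. *)
Lemma powR_le_add t s u v : 0 < t -> u <= s -> s <= v -> t `^ s <= t `^ u + t `^ v.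
Proof.
move=> t0 us sv; have [t1|t1] := lerP 1 t.
  by rewrite (le_trans (ler_powR t1 sv)) // lerDr powR_ge0.
have t01 : 0 < t <= 1 by rewrite t0 ltW.
by rewrite (le_trans (ger_powR t01 us)) // lerDl powR_ge0.
Qed.

Lemma continuous_expRN : continuous (fun t : R => expR (- t)).
Proof.
by move=> t; apply: continuous_comp; [exact: opp_continuous | exact: continuous_expR].
Qed.

Lemma is_derive_expRN t : is_derive t 1 (fun t : R => - expR (- t)) (expR (- t)).
Proof. by apply: is_derive_eq; rewrite mulrN1 opprK. Qed.

Lemma measurable_gamma_integrand z (D : set R) :
  measurable_fun D (EFin \o (fun t : R => t `^ z * expR (- t))).
Proof.
apply/measurable_EFinP; apply: (@measurable_funS _ _ _ _ setT) => //.
apply: measurable_funM => //.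
by apply: measurableT_comp => //; exact: measurableT_comp.
Qed.

Lemma gamma_integrand_ge0 z t : 0 <= t `^ z * expR (- t).
Proof. by rewrite mulr_ge0 ?powR_ge0 ?expR_ge0. Qed.

(** Euler's integral as an extended real, which allows the functional equation
    to be proved before convergence is known. *)
Definition gamma_int z : \bar R :=
  (\int[mu]_(t in `]0%R, +oo[) (t `^ (z - 1) * expR (- t))%:E)%E.

(** The boundary term of the integration by parts at n + 2: since
    exp(t) >= t^(k+1)/(k+1)!, it is at most (k+1)!/t for any integer k >= z. *)
Lemma gamma_boundary_infty z :
  (n.+2%:R `^ z * expR (- n.+2%:R)) @[n --> \oo] --> (0 : R).
Proof.
have [k zk] : exists k : nat, z <= k%:R.
  by exists (Num.bound `|z|); rewrite ltW // (le_lt_trans (ler_norm z)) // archi_boundP.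
apply: (@squeeze_cvgr _ _ _ _ (fun=> 0) (fun n => k.+1`!%:R * (n.+2%:R)^-1)).
- near=> n; rewrite gamma_integrand_ge0 /=.
  have n0 : 0 < n.+2%:R :> R by rewrite ltr0n.
  have n1 : 1 <= n.+2%:R :> R by rewrite ler1n.
  apply: (@le_trans _ _ (n.+2%:R ^+ k * expR (- n.+2%:R))).
    by rewrite ler_pM2r ?expR_gt0 // -powR_mulrn ?ler_powR // ltW.
  rewrite expRN ler_pdivrMr ?expR_gt0 // mulrAC ler_pdivlMr // -exprSr.
  rewrite -ler_pdivrMl ?ltr0n ?fact_gt0 // mulrC.
  by apply: le_trans (expR_ge1Dxn k (ltW n0)); rewrite lerDr.
- exact: cvg_cst.
- rewrite -[X in _ --> X](mulr0 (k.+1`!%:R)); apply: cvgMr.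
  have := @cvg_harmonic R; rewrite -(cvg_shiftn 1) /=.
  by under eq_fun do rewrite addn1.
Unshelve. all: by end_near. Qed.

Lemma gamma_boundary_0 z : 0 < z ->
  ((n.+2%:R)^-1 `^ z * expR (- (n.+2%:R)^-1)) @[n --> \oo] --> (0 : R).
Proof.
move=> z0.
apply: (@squeeze_cvgr _ _ _ _ (fun=> 0) (fun n => (n.+2%:R)^-1 `^ z)).
- near=> n; rewrite gamma_integrand_ge0 /=.
  by rewrite ler_piMr ?powR_ge0 // expR_le1 oppr_le0 invr_ge0.
- exact: cvg_cst.
- move/cvg_at_rightP : (powR_cvg0 z0); apply; split=> [n|].
    by rewrite invr_gt0.
  have := @cvg_harmonic R; rewrite -(cvg_shiftn 1) /=.
  by under eq_fun do rewrite addn1.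
Unshelve. all: by end_near. Qed.

(** Compact intervals exhausting the positive half-line; starting at n + 2 keeps
    the end points distinct. *)
Let itvn (n : nat) : set R := `[(n.+2%:R)^-1, n.+2%:R].

Lemma itvn_bigcup : \bigcup_n itvn n = `]0%R, +oo[%classic.
Proof.
apply/seteqP; split => [x [n _] /=|x /=]; rewrite !in_itv /= ?andbT.
  by rewrite /itvn /= in_itv => /andP[nx _]; apply: lt_le_trans nx; rewrite invr_gt0.
move=> x0; pose n := Num.bound (Num.max x x^-1); exists n => //=.
rewrite /itvn /= in_itv /=.
have m0 : 0 <= Num.max x x^-1 by rewrite le_max ltW.
have nn : n%:R <= n.+2%:R :> R by rewrite ler_nat; lia.
have := le_trans (ltW (archi_boundP m0)) nn; rewrite ge_max => /andP[xn xn'].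
by rewrite xn andbT -[leRHS]invrK lef_pV2 // ?posrE ?invr_gt0.
Qed.

Lemma gamma_int_cvg z :
  (\int[mu]_(t in itvn n) (t `^ (z - 1) * expR (- t))%:E)%E @[n --> \oo]
    --> gamma_int z.
Proof.
rewrite /gamma_int -itvn_bigcup; apply: ge0_nondecreasing_set_cvg_integral.
- apply/nondecreasing_seqP => n; rewrite subsetEset /itvn.
  apply: subset_itv; rewrite bnd_simp ?lef_pV2 ?posrE ?ltr0n // ler_nat; lia.
- by move=> n; exact: measurable_itv.
- by move=> n; exact: measurable_gamma_integrand.
- by move=> n x _; rewrite lee_fin gamma_integrand_ge0.
Qed.

Lemma gamma_parts z n : 0 < z ->
  (\int[mu]_(t in itvn n) (t `^ (z + 1 - 1) * expR (- t))%:E =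
   ((n.+2%:R)^-1 `^ z * expR (- (n.+2%:R)^-1)
     - n.+2%:R `^ z * expR (- n.+2%:R))%:E
   + z%:E * \int[mu]_(t in itvn n) (t `^ (z - 1) * expR (- t))%:E)%E.
Proof.
move=> z0; rewrite addrK.
have n0 : 0 < n.+2%:R^-1 :> R by rewrite invr_gt0.
have nn : n.+2%:R^-1 < n.+2%:R :> R.
  apply: (@lt_trans _ _ 1); last by rewrite ltr1n.
  by rewrite invf_lt1 ?ltr1n.
have pos t : t \in `[n.+2%:R^-1, n.+2%:R] -> 0 < t :> R.
  by rewrite in_itv /= => /andP[+ _]; exact: lt_le_trans.
have cpow s : {in `[n.+2%:R^-1, n.+2%:R],
    forall t : R, {for t, continuous (@powR R ^~ s)}}.
  move=> t /pos t0; apply: differentiable_continuous.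
  by apply/derivable1_diffP; apply: derivable_powR; rewrite in_itv /= t0.
have an : n.+2%:R^-1 \in `[n.+2%:R^-1, n.+2%:R :> R] by rewrite in_itv /= lexx ltW.
have bn : n.+2%:R \in `[n.+2%:R^-1, n.+2%:R :> R] by rewrite in_itv /= lexx ltW.
have dexp := is_derive_expRN.
have cntw (f : R -> R) :
    {in `[n.+2%:R^-1, n.+2%:R], forall t : R, {for t, continuous f}} ->
    {within itvn n, continuous f}.
  by move=> cf; apply: continuous_in_subspaceT => x /set_mem/= /cf.
have dpow : derivable_oo_LRcontinuous (@powR R ^~ z) n.+2%:R^-1 n.+2%:R.
  split=> [t tn||].
  - apply: derivable_powR; rewrite in_itv /= andbT; apply: pos.
    by apply: subset_itv_oo_cc tn.
  - by apply: cvg_at_right_filter; exact: cpow.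
  - by apply: cvg_at_left_filter; exact: cpow.
have dexpI : derivable_oo_LRcontinuous (fun t : R => - expR (- t)) n.+2%:R^-1 n.+2%:R.
  split=> [t _||].
  - exact: ex_derive.
  - by apply: cvg_at_right_filter; apply: cvgN; exact: continuous_expRN.
  - by apply: cvg_at_left_filter; apply: cvgN; exact: continuous_expRN.
rewrite (@integration_by_parts R (@powR R ^~ z) (fun t => - expR (- t))
  (fun t => z * t `^ (z - 1)) (fun t => expR (- t)) _ _ nn) //.
- congr (_ + _)%E; first by congr EFin; rewrite !mulrN opprK addrC.
  pose k (t : R) : \bar R := (t `^ (z - 1) * expR (- t))%:E.
  have ik : mu.-integrable (itvn n) k.
    apply: continuous_compact_integrable; first exact: segment_compact.
    by apply: cntw => t tn; apply: cvgM; [exact: cpow | exact: continuous_expRN].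
  have := @integralZl _ _ R mu (itvn n) (measurable_itv _) k ik (- z).
  rewrite EFinN mulNe => /(congr1 oppe); rewrite oppeK => <-.
  congr (- _)%E; apply: eq_integral => t _.
  by rewrite /k -EFinN -EFinM mulrN mulNr mulrA.
- by apply: cntw => t tn; apply: cvgM; [exact: cvg_cst | exact: cpow].
- move=> t tn; rewrite powR_derive1 // in_itv /= andbT; apply: pos.
  by apply: subset_itv_oo_cc tn.
- by apply: cntw => t tn; exact: continuous_expRN.
- by move=> t tn; rewrite derive1E derive_val.
Qed.

(** The limit of [gamma_parts], valid in the extended reals. *)
Lemma gamma_int_rec z : 0 < z -> gamma_int (z + 1) = (z%:E * gamma_int z)%E.
Proof.
move=> z0; rewrite -(cvg_lim (@ereal_hausdorff R) (@gamma_int_cvg (z + 1))).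
apply: cvg_lim => //.
rewrite -[X in _ --> X]add0e.
under eq_fun do rewrite gamma_parts //.
apply: cvgeD => //.
- apply: cvg_EFin; first exact: nearW.
  rewrite -[X in _ --> X](subrr 0); apply: cvgB; first exact: gamma_boundary_0.
  exact: gamma_boundary_infty.
- by apply: cvgeZl => //; exact: gamma_int_cvg.
Qed.

Lemma gamma_int_ge0 z : (0 <= gamma_int z)%E.
Proof. by apply: integral_ge0 => t _; rewrite lee_fin gamma_integrand_ge0. Qed.

Lemma gamma_int1_lty : (gamma_int 1 < +oo)%E.
Proof.
rewrite /gamma_int subrr.
rewrite integral_itv_obnd_cbnd; last exact: measurable_gamma_integrand.
under eq_integral do rewrite powRr0 mul1r.
have dexp := is_derive_expRN.
rewrite (@ge0_continuous_FTC2y R (fun t => expR (- t)) (fun t => - expR (- t)) 0 0).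
- by rewrite -EFinB ltry.
- by move=> t _; rewrite expR_ge0.
- by apply: continuous_subspaceT; exact: continuous_expRN.
- by rewrite -oppr0; apply: cvgN; exact: cvgr_expR.
- by move=> t _; exact: ex_derive.
- by apply: cvg_at_right_filter; apply: cvgN; exact: continuous_expRN.
- by move=> t _; rewrite derive1E derive_val.
Qed.

Lemma gamma_int_le_add z u v : u <= z -> z <= v ->
  (gamma_int z <= gamma_int u + gamma_int v)%E.
Proof.
move=> uz zv; rewrite /gamma_int -ge0_integralD //=.
- apply: ge0_le_integral => //=.
  + by move=> t _; rewrite lee_fin gamma_integrand_ge0.
  + exact: measurable_gamma_integrand.
  + by apply: emeasurable_funD; exact: measurable_gamma_integrand.
  + move=> t; rewrite in_itv /= andbT => t0; rewrite -EFinD lee_fin -mulrDl.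
    by rewrite ler_pM2r ?expR_gt0 // powR_le_add // lerB.
- by move=> t _; rewrite lee_fin gamma_integrand_ge0.
- exact: measurable_gamma_integrand.
- by move=> t _; rewrite lee_fin gamma_integrand_ge0.
- exact: measurable_gamma_integrand.
Qed.

(** Gamma(n) is finite at positive integers by the functional equation, at
    z >= 1 by comparison with 1 and a larger integer, and at z > 0 because
    Gamma(z+1) = z Gamma(z), which settles the singularity at 0. *)
Lemma gamma_int_lty z : 0 < z -> (gamma_int z < +oo)%E.
Proof.
have gnat n : (gamma_int n.+1%:R < +oo)%E.
  elim: n => [|n IH]; first exact: gamma_int1_lty.
  rewrite -natr1 gamma_int_rec // -ge0_fin_numE ?mule_ge0 ?gamma_int_ge0 //.
  by rewrite fin_numM // ge0_fin_numE // gamma_int_ge0.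
have g1 s : 1 <= s -> (gamma_int s < +oo)%E.
  move=> s1; have s0 : 0 <= s by lra.
  apply: le_lt_trans (gamma_int_le_add s1 (_ : s <= (Num.bound s).+1%:R)) _.
    by rewrite (le_trans (ltW (archi_boundP s0))) // ler_nat.
  by apply: lte_add_pinfty; [exact: gamma_int1_lty | exact: gnat].
move=> z0; have := g1 (z + 1) ltac:(lra); rewrite gamma_int_rec //.
rewrite -!ge0_fin_numE ?gamma_int_ge0 //; last first.
  by rewrite mule_ge0 ?gamma_int_ge0 ?lee_fin ?ltW.
have : (0 <= gamma_int z)%E := gamma_int_ge0 z.
by case: (gamma_int z) => // _; rewrite gt0_muley // lte_fin.
Qed.

Lemma GammaE z : Gamma z = fine (gamma_int z). Proof. by []. Qed.

Lemma gammaS z : 0 < z -> Gamma (z + 1) = z * Gamma z.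
Proof.
move=> z0; rewrite !GammaE gamma_int_rec // fineM //.
by rewrite ge0_fin_numE ?gamma_int_ge0 // gamma_int_lty.
Qed.

(** By the functional equation it is enough to treat z >= 1, where the integrand
    is at least exp(-2) on [1, 2]. *)
Lemma gamma_gt0 z : 0 < z -> 0 < Gamma z.
Proof.
have lb s : 1 <= s -> (0 < gamma_int s)%E.
  move=> s1; pose m : R := expR (- 2).
  have sub : `[1%R, 2%R]%classic `<=` (`]0%R, +oo[%classic : set R).
    by apply: subset_itv; rewrite bnd_simp.
  apply: (@lt_le_trans _ _ (\int[mu]_(t in `[1%R, 2%R]) m%:E)%E).
    rewrite integral_cst //= lebesgue_measure_itv /= lte_fin ltr1n /=.
    by rewrite -EFinB -EFinM lte_fin mulr_gt0 ?expR_gt0 //; lra.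
  apply: (@le_trans _ _ (\int[mu]_(t in `[1%R, 2%R]) (t `^ (s - 1) * expR (- t))%:E)%E).
    apply: ge0_le_integral => //=.
    + by move=> t _; rewrite lee_fin expR_ge0.
    + exact: measurable_gamma_integrand.
    + move=> t; rewrite in_itv /= => /andP[t1 t2]; rewrite lee_fin -[leLHS]mul1r.
      apply: ler_pM; rewrite ?expR_ge0 // ?ler_expR ?lerN2 //.
      by rewrite -[leLHS](powRr0 t) ler_powR // subr_ge0.
  apply: ge0_subset_integral => //=; first exact: measurable_gamma_integrand.
  by move=> t _; rewrite lee_fin gamma_integrand_ge0.
move=> z0; rewrite -(pmulr_rgt0 _ z0) -gammaS // GammaE fine_gt0 //.
by rewrite lb ?gamma_int_lty //; lra.
Qed.

Lemma gamma_integrable z : 0 < z ->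
  mu.-integrable `]0, +oo[ (EFin \o (fun t : R => t `^ (z - 1) * expR (- t))).
Proof.
move=> z0; apply/integrableP; split; first exact: measurable_gamma_integrand.
under eq_integral => t _ do rewrite gee0_abs ?lee_fin ?gamma_integrand_ge0 //.
exact: gamma_int_lty.
Qed.

(** Dominated convergence: around z the integrands are bounded by the sum of
    those at z / 2 and z + 1. *)
Lemma continuous_Gamma z : 0 < z -> {for z, continuous (@Gamma R)}.
Proof.
move=> z0; pose u := z / 2; pose v := z + 1.
have zuv : z \in (`]u, v[%classic : set R).
  by rewrite inE /= in_itv /= /u /v; apply/andP; split; lra.
apply: (@continuity_under_integral R _ _ mu
  (fun z t => t `^ (z - 1) * expR (- t)) `]0, +oo[ _ u v _ _
  (fun t => (t `^ (u - 1) + t `^ (v - 1)) * expR (- t))) zuv => //.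
- move=> s; rewrite /= in_itv /= => /andP[us _]; apply: gamma_integrable.
  by rewrite /u in us; lra.
- apply: aeW => t; rewrite /= in_itv /= andbT => t0 s _.
  have -> : (fun s => t `^ (s - 1) * expR (- t)) =
      (fun s => expR ((s - 1) * ln t) * expR (- t)).
    by apply/funext => r; rewrite /powR gt_eqF.
  apply: cvgM; last exact: cvg_cst.
  apply: continuous_comp; last exact: continuous_expR.
  by apply: cvgM; [apply: cvgB; [exact: cvg_id | exact: cvg_cst] | exact: cvg_cst].
- have -> : (EFin \o (fun t : R => (t `^ (u - 1) + t `^ (v - 1)) * expR (- t))) =
    ((EFin \o (fun t : R => t `^ (u - 1) * expR (- t))%R)
     \+ (EFin \o (fun t : R => t `^ (v - 1) * expR (- t))%R))%E.
    by apply/funext => t /=; rewrite mulrDl.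
  by apply: integrableD => //; apply: gamma_integrable; rewrite /u /v; lra.
- move=> s; rewrite /= in_itv /= => /andP[us sv]; apply: aeW => t.
  rewrite /= in_itv /= andbT => t0.
  rewrite ger0_norm ?gamma_integrand_ge0 // ler_pM2r ?expR_gt0 // powR_le_add //; lra.
Qed.

End GammaFacts.

(** * Power series with nonnegative coefficients *)

Section NonnegPowerSeries.
Context {R : realType}.
Implicit Types (f h c a b : nat -> R) (x y r : R).

Lemma series_nonneg_le_lim a n : (forall k, 0 <= a k) -> cvgn (series a) ->
  series a n <= limn (series a).
Proof.
move=> a0 ca; apply: nondecreasing_cvgn_le => //.
by apply/nondecreasing_seqP => m; rewrite seriesSr lerDl.
Qed.

Lemma pseries_term_ge0 f x k : (forall k, 0 <= f k) -> 0 <= x -> 0 <= f k * x ^+ k.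
Proof. by move=> f0 x0; rewrite mulr_ge0 // exprn_ge0. Qed.

Lemma psum_ge0 f x : (forall k, 0 <= f k) -> 0 <= x -> cvgn (pseries f x) ->
  0 <= psum f x.
Proof.
move=> f0 x0 cf; have := series_nonneg_le_lim 0 _ cf.
by rewrite /series /= big_geq //; apply => k; exact: pseries_term_ge0.
Qed.

Lemma le_psum f x n : (forall k, 0 <= f k) -> 0 <= x -> cvgn (pseries f x) ->
  pseries f x n <= psum f x.
Proof.
by move=> f0 x0 cf; apply: series_nonneg_le_lim => // k; exact: pseries_term_ge0.
Qed.

(** The partial sum is a sum over the triangle i + j < N, here cut into rows. *)
Lemma series_cauchy_product a b N :
  series (pmul a b) N = \sum_(0 <= i < N) a i * series b (N - i)%N.
Proof.
elim: N => [|N IH]; first by rewrite /series /= !big_geq.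
rewrite seriesSr IH big_nat_recr //= subSnn.
have -> : series b 1%N = b 0%N by rewrite /series /= big_nat1.
rewrite /pmul big_ord_recr /= subnn addrA; congr (_ + _).
rewrite big_mkord -big_split /= big_mkord; apply: eq_bigr => i _.
by rewrite subSn 1?ltnW // seriesSr mulrDr.
Qed.

(** The triangle of side N lies in the square of side N, which lies in the
    triangle of side 2 N. *)
Lemma cvg_series_cauchy_product a b : (forall k, 0 <= a k) -> (forall k, 0 <= b k) ->
    cvgn (series a) -> cvgn (series b) ->
  series (pmul a b) @ \oo --> limn (series a) * limn (series b).
Proof.
move=> a0 b0 ca cb.
have bmono : {homo series b : n m / (n <= m)%N >-> n <= m}.
  by apply/nondecreasing_seqP => m; rewrite seriesSr lerDl.
have bS0 n : 0 <= series b n by apply: sumr_ge0.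
have upper N : series (pmul a b) N <= series a N * series b N.
  rewrite series_cauchy_product mulr_suml; apply: ler_sum => i _.
  by rewrite ler_wpM2l // bmono // leq_subr.
have lower N : series a N * series b N <= series (pmul a b) (N + N)%N.
  rewrite series_cauchy_product (big_cat_nat _ (n := N)) //= ?leq_addr //.
  rewrite mulr_suml -[leLHS]addr0 lerD //; last first.
    by apply: sumr_ge0 => i _; rewrite mulr_ge0.
  apply: ler_sum_nat => i /andP[_ iN].
  by rewrite ler_wpM2l // bmono //; lia.
have mono : nondecreasing_seq (series (pmul a b)).
  apply/nondecreasing_seqP => m; rewrite seriesSr lerDl.
  by apply: sumr_ge0 => i _; rewrite mulr_ge0.
have cab : series a \* series b @ \oo --> limn (series a) * limn (series b).
  exact: cvgM.
have bnd : has_ubound (range (series (pmul a b))).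
  exists (limn (series a) * limn (series b)) => _ [n _ <-].
  apply: le_trans (upper n) _; apply: ler_pM => //; first by apply: sumr_ge0.
    exact: series_nonneg_le_lim.
  exact: series_nonneg_le_lim.
have cP := nondecreasing_is_cvgn mono bnd.
have -> : limn (series a) * limn (series b) = limn (series (pmul a b)); last exact: cP.
apply/eqP; rewrite eq_le; apply/andP; split.
  rewrite -(cvg_lim _ cab) //; apply: limr_le; first by apply: cvgP cab.
  apply: nearW => n; apply: le_trans (lower n) _; exact: nondecreasing_cvgn_le.
rewrite -(cvg_lim _ cab) //; apply: ler_lim => //; first by apply: cvgP cab.
exact: nearW.
Qed.

Lemma cvg_pseries_pmul f h x : (forall k, 0 <= f k) -> (forall k, 0 <= h k) ->
    0 <= x -> cvgn (pseries f x) -> cvgn (pseries h x) ->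
  pseries (pmul f h) x @ \oo --> psum f x * psum h x.
Proof.
move=> f0 h0 x0 cf ch.
have := cvg_series_cauchy_product (fun k => pseries_term_ge0 k f0 x0)
  (fun k => pseries_term_ge0 k h0 x0) cf ch.
suff -> : pmul (fun k => f k * x ^+ k) (fun k => h k * x ^+ k) =
    (fun n => pmul f h n * x ^+ n) by [].
apply/funext => n; rewrite /pmul mulr_suml; apply: eq_bigr => k _.
have kn : (k <= n)%N by rewrite -ltnS.
by rewrite mulrACA -exprD (subnKC kn).
Qed.

Lemma cvg_pseries_le f x y : 0 <= y -> y <= x -> cvgn (pseries f x) ->
  cvgn (pseries f y).
Proof.
move=> y0; rewrite le_eqVlt => /predU1P[->//|yx] /is_cvg_pseries_inside; apply.
by rewrite !ger0_norm // ltW // (le_lt_trans y0).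
Qed.

(** Comparison with the series at x, since
    (n+1) y^n (x - y) <= x^(n+1) - y^(n+1) <= x^(n+1). *)
Lemma cvg_pseries_diffs c x y : (forall k, 0 <= c k) -> 0 <= y -> y < x ->
  cvgn (pseries c x) -> cvgn (pseries (pseries_diffs c) y).
Proof.
move=> c0 y0 yx cx; have x0 : 0 < x by rewrite (le_lt_trans y0).
have d0 : 0 < x - y by rewrite subr_gt0.
have powb n : n.+1%:R * y ^+ n <= x ^+ n.+1 / (x - y).
  rewrite ler_pdivlMr // (@le_trans _ _ (x ^+ n.+1 - y ^+ n.+1)) //; last first.
    by rewrite gerBl exprn_ge0.
  rewrite subrXX mulrC ler_pM2l // mulr_natl -[X in _ *+ X]card_ord -sumr_const.
  apply: ler_sum => i _.
  have ni : (i <= n)%N by rewrite -ltnS.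
  rewrite -[X in y ^+ X](subnK ni) exprD /= ler_wpM2r ?exprn_ge0 //.
  by rewrite lerXn2r ?nnegrE // ltW.
apply: (@series_le_cvg _ _ (fun n => (x - y)^-1 * (c n.+1 * x ^+ n.+1))) => [n|n|n|].
- by rewrite /pseries_diffs !mulr_ge0 // exprn_ge0.
- by rewrite !mulr_ge0 ?exprn_ge0 ?invr_ge0 // ltW.
- rewrite /pseries_diffs /= mulrAC [leLHS]mulrC [leRHS]mulrCA.
  by rewrite ler_wpM2l // [leRHS]mulrC.
- rewrite (_ : (fun n => _) = (x - y)^-1 *: (fun n => c n.+1 * x ^+ n.+1)) //.
  apply: is_cvg_seriesZ.
  have := cx; rewrite /pseries => /cvg_ex [l hl].
  rewrite -(cvg_shiftS (series (fun n => c n * x ^+ n))) in hl.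
  apply/cvg_ex; exists (l - c 0%N).
  rewrite (_ : series _ = (fun n => series (fun n => c n * x ^+ n) n.+1 - c 0%N)).
    by apply: cvgB => //; exact: cvg_cst.
  apply/funext => n; rewrite /series /= big_nat_recl // expr0 mulr1.
  by rewrite addrC addKr.
Qed.

(** Closure under decreasing the argument makes I an interval starting at 0, or
    the empty set; the right end point may belong to it. *)
Definition nonneg_psum_on (I : set R) (c : nat -> R) (f : R -> R) : Prop :=
  [/\ forall n, 0 <= c n,
      forall x, I x -> [/\ 0 < x, cvgn (pseries c x) & f x = psum c x] &
      forall x y, I x -> 0 < y -> y <= x -> I y].

(** Tails increase with the argument, so a tail at x controls the tails at all
    smaller points uniformly. *)
Lemma pseries_tail_le c x y n : (forall k, 0 <= c k) -> 0 <= y -> y <= x ->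
    cvgn (pseries c x) ->
  psum c y - pseries c y n <= psum c x - pseries c x n.
Proof.
move=> c0 y0 yx cx; have cy := cvg_pseries_le y0 yx cx.
have key m : (n <= m)%N -> pseries c y m - pseries c y n <= psum c x - pseries c x n.
  move=> nm; apply: (@le_trans _ _ (pseries c x m - pseries c x n)).
    rewrite !sub_series_geq //; apply: ler_sum_nat => i _.
    by rewrite ler_wpM2l // lerXn2r ?nnegrE // (le_trans y0).
  by rewrite lerB // le_psum // (le_trans y0).
rewrite lerBlDr; apply: limr_le => //.
by exists n => // m /= nm; rewrite -lerBlDr key.
Qed.

Lemma continuous_pseries_partial c n x : {for x, continuous (fun y => pseries c y n)}.
Proof.
elim: n => [|n IH].
  rewrite (_ : (fun y => _) = fun=> 0); first exact: cvg_cst.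
  by apply/funext => y; rewrite /pseries /series /= big_geq.
rewrite (_ : (fun y => _) = (fun y => pseries c y n + c n * y ^+ n)).
  apply: cvgD; first exact: IH.
  by apply: cvgM; [exact: cvg_cst | exact: exprn_continuous].
by apply/funext => y; rewrite /pseries seriesSr.
Qed.

(** Some r in I bounds all points of I near x: a point beyond x if there is one,
    otherwise x itself. The tails at those points are bounded by the tail at r,
    and the partial sums are continuous. *)
Lemma psum_within_continuous I c (f : R -> R) : nonneg_psum_on I c f ->
  {within I, continuous f}.
Proof.
move=> [c0 If Idown]; apply/subspace_continuousP => x Ix.
have [r [Ir xr nr]] : exists r, [/\ I r, x <= r & \forall y \near x, I y -> y <= r].
  have [[r [Ir xr]]|max] := pselect (exists r, I r /\ x < r).
    exists r; split => //; first exact: ltW.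
    by apply: filterS (lt_nbhsl xr) => y yr _; exact: ltW.
  exists x; split => //; apply: (@nearW _ (nbhs x)) => y Iy.
  by rewrite leNgt; apply/negP => xy; apply: max; exists y.
have [r0 cr fr] := If _ Ir; have [x0 cx fx] := If _ Ix.
apply/cvgrPdist_lt => e e0.
have e3 : 0 < e / 3 by lra.
have [n tail] : exists n, psum c r - pseries c r n < e / 3.
  have /cvgrPdist_lt /(_ _ e3) [n _ /(_ n (leqnn n))] := cr.
  by move=> /(le_lt_trans (ler_norm _)) ?; exists n.
have /cvgrPdist_lt /(_ _ e3) near_partial := @continuous_pseries_partial c n x.
rewrite near_withinE; near=> y => Iy.
have [y0 cy fy] := If _ Iy.
have yr : y <= r by move: Iy; near: y.
have t1 := pseries_tail_le n c0 (ltW y0) yr cr.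
have t2 := pseries_tail_le n c0 (ltW x0) xr cr.
have p1 := le_psum n c0 (ltW y0) cy.
have p2 := le_psum n c0 (ltW x0) cx.
have : `|pseries c x n - pseries c y n| < e / 3 by near: y.
rewrite /from_subspace fx fy !ltr_norml => /andP[??]; apply/andP; split; lra.
Unshelve. all: by end_near. Qed.

Lemma interior_larger (I : set R) x : I° x -> exists2 r, I r & x < r.
Proof.
move=> /nbhs_ballP [e /= e0 eI]; exists (x + e / 2); last by rewrite ltrDl divr_gt0.
apply: eI; rewrite /ball /= opprD addrA subrr sub0r normrN gtr0_norm ?divr_gt0 //.
by rewrite ltr_pdivrMr // ltr_pMr // ltr1n.
Qed.

Lemma iter_pseries_diffs_ge0 c m k : (forall n, 0 <= c n) ->
  0 <= iter m (@pseries_diffs R) c k.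
Proof.
by move=> c0; elim: m k => [|m IH] k //=; rewrite /pseries_diffs mulr_ge0.
Qed.

(** Differentiating repeatedly loses convergence at the right end point but not
    to the left of it, and an interior point of I has points of I on its right. *)
Lemma psum_derive1n I c (f : R -> R) n x : nonneg_psum_on I c f -> I° x ->
  [/\ cvgn (pseries (iter n (@pseries_diffs R) c) x),
      derivable (derive1n n f) x 1 &
      derive1n n f x = psum (iter n (@pseries_diffs R) c) x].
Proof.
move=> [c0 If Idown].
have Dcvg r m y : I r -> 0 <= y -> y < r ->
    cvgn (pseries (iter m (@pseries_diffs R) c) y).
  move=> Ir; elim: m y => [|m IH] y y0 yr.
    by have [_ cr _] := If _ Ir; apply: cvg_pseries_le cr => //; exact: ltW.
  have [k1 k2] := midf_lt yr.
  apply: (cvg_pseries_diffs _ y0 k1); first by move=> k; exact: iter_pseries_diffs_ge0.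
  by apply: IH => //; lra.
have Dder m y : I° y -> is_derive y 1 (psum (iter m (@pseries_diffs R) c))
    (psum (iter m.+1 (@pseries_diffs R) c) y).
  move=> /[dup] /interior_subset /If [y0 _ _] /interior_larger [r Ir yr].
  have [k1 k2] := midf_lt yr.
  have K0 : 0 <= (y + r) / 2 by lra.
  apply: (@pseries_snd_diffs R _ ((y + r) / 2)).
  - exact: (Dcvg r m).
  - exact: (Dcvg r m.+1).
  - exact: (Dcvg r m.+2).
  - by rewrite !ger0_norm // ltW.
have near_interior (P : R -> Prop) y : I° y -> (forall w, I° w -> P w) ->
    \forall w \near y, P w.
  move=> Iy PI; apply: (@filterS _ (nbhs y) _ I°); first exact: PI.
  by apply: open_nbhs_nbhs; split => //; exact: open_interior.
have Dn m y : I° y -> derive1n m f y = psum (iter m (@pseries_diffs R) c) y.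
  elim: m y => [|m IH] y Iy; first by have [] := If _ (interior_subset Iy).
  rewrite derive1nS derive1E.
  have [_ <-] := Dder m y Iy.
  by apply: near_eq_derive; exact: (near_interior _ y Iy).
move=> Ix; split; last exact: Dn.
  have [r Ir xr] := interior_larger Ix.
  by have [x0 _ _] := If _ (interior_subset Ix); apply: (Dcvg r) => //; exact: ltW.
have [d _] := Dder n x Ix.
apply: near_eq_derivable d; apply: (near_interior _ x Ix) => w Iw.
by rewrite Dn.
Qed.

Lemma psum_absolutely_monotonic I c (f : R -> R) : nonneg_psum_on I c f ->
  absolutely_monotonic I f.
Proof.
move=> H; have [c0 If Idown] := H; split => [x /If [x0 cx ->]||n x Ix].
- exact: psum_ge0 (ltW x0) cx.
- exact: psum_within_continuous H.
have [cx d ->] := psum_derive1n n H Ix; split => //.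
have [x0 _ _] := If _ (interior_subset Ix).
by apply: psum_ge0 (ltW x0) cx => k; exact: iter_pseries_diffs_ge0.
Qed.

(** The tangent to exp at the weighted mean m of ln u and ln v lies below exp:
    exp(m) (1 + ln u - m) <= u, and likewise for v. The weighted combination of
    the two inequalities is the claim. *)
Lemma weighted_am_gm (u v l : R) : 0 < u -> 0 < v -> 0 <= l <= 1 ->
  u `^ l * v `^ (1 - l) <= l * u + (1 - l) * v.
Proof.
move=> u0 v0 /andP[l0 l1].
rewrite /powR !gt_eqF // -expRD; set m := _ + _.
have tangent w : 0 < w -> expR m * (1 + ln w - m) <= w.
  move=> w0; have := expR_ge1Dx (ln w - m).
  rewrite expRB lnK // ler_pdivlMr ?expR_gt0 //.
  by rewrite mulrC addrA.
apply: (@le_trans _ _ (l * (expR m * (1 + ln u - m))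
    + (1 - l) * (expR m * (1 + ln v - m)))).
  rewrite (_ : _ + _ * _ = expR m * (1 + (l * ln u + (1 - l) * ln v) - m)).
    by rewrite -/m addrK mulr1.
  by ring.
by apply: lerD; apply: ler_wpM2l; rewrite ?subr_ge0 ?tangent.
Qed.

(** Hoelder's inequality for the sums A and B of the series at x and y: each
    power of z = x^l y^(1-l) is bounded by [weighted_am_gm] applied to x^n/A and
    y^n/B; multiplying by the coefficients and summing gives A^l B^(1-l). If A or
    B vanishes, then so do all the coefficients. *)
Lemma psum_multiplicatively_convex I c (f : R -> R) : nonneg_psum_on I c f ->
  multiplicatively_convex I f.
Proof.
move=> [c0 If Idown]; split=> [x /If [x0 cx ->]|x y l Ix Iy l01].
  exact: psum_ge0 (ltW x0) cx.
have [x0 cx fx] := If _ Ix; have [y0 cy fy] := If _ Iy.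
have /andP[l0 l1] := l01.
set z := x `^ l * y `^ (1 - l).
have z0 : 0 < z by rewrite mulr_gt0 ?powR_gt0.
have zle : z <= Num.max x y.
  apply: le_trans (weighted_am_gm x0 y0 l01) _.
  rewrite -[leRHS](_ : l * Num.max x y + (1 - l) * Num.max x y = _); last by ring.
  by apply: lerD; apply: ler_wpM2l; rewrite ?subr_ge0 // le_max lexx ?orbT.
have Iz : I z.
  by move: zle; rewrite le_max => /orP[]; [exact: (Idown x) | exact: (Idown y)].
have [_ cz fz] := If _ Iz.
have A0 := psum_ge0 c0 (ltW x0) cx; have B0 := psum_ge0 c0 (ltW y0) cy.
rewrite fz fx fy.
have zero w : 0 < w -> cvgn (pseries c w) -> psum c w = 0 -> psum c z <= 0.
  move=> w0 cw pw.
  have cn n : c n = 0.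
    have := le_psum n.+1 c0 (ltW w0) cw; rewrite pw /pseries seriesSr => H.
    have {}H : series (fun i => c i * w ^+ i) n + c n * w ^+ n <= 0 := H.
    have S0 : 0 <= series (fun i => c i * w ^+ i) n.
      by apply: sumr_ge0 => i _; exact: pseries_term_ge0 (ltW w0).
    have t0 := pseries_term_ge0 n c0 (ltW w0).
    have : c n * w ^+ n == 0 by rewrite eq_le t0 andbT; lra.
    by rewrite mulf_eq0 expf_eq0 (gt_eqF w0) andbF orbF => /eqP.
  apply: limr_le => //; apply: nearW => n.
  by rewrite /pseries /series /= big1 // => i _; rewrite cn mul0r.
have [A1|A1] := eqVneq (psum c x) 0.
  by apply: le_trans (zero x x0 cx A1) _; rewrite mulr_ge0 ?powR_ge0.
have [B1|B1] := eqVneq (psum c y) 0.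
  by apply: le_trans (zero y y0 cy B1) _; rewrite mulr_ge0 ?powR_ge0.
have {A0}A0 : 0 < psum c x by rewrite lt_neqAle eq_sym A1.
have {B0}B0 : 0 < psum c y by rewrite lt_neqAle eq_sym B1.
move: {A1 B1}(psum c x) (psum c y) A0 B0
  (fun n => le_psum n c0 (ltW x0) cx) (fun n => le_psum n c0 (ltW y0) cy).
move=> A B A0 B0 leA leB.
set C := A `^ l * B `^ (1 - l).
have C0 : 0 < C by rewrite mulr_gt0 ?powR_gt0.
have term n : z ^+ n <= C * (l * (x ^+ n / A) + (1 - l) * (y ^+ n / B)).
  have xA : 0 < x ^+ n / A by rewrite divr_gt0 ?exprn_gt0.
  have yB : 0 < y ^+ n / B by rewrite divr_gt0 ?exprn_gt0.
  apply: le_trans (ler_wpM2l (ltW C0) (weighted_am_gm xA yB l01)).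
  have powX w p : 0 <= w -> (w ^+ n) `^ p = (w `^ p) ^+ n.
    by move=> w0; rewrite -(powR_mulrn n w0) -(powR_mulrn n (powR_ge0 w p)) powRAC.
  have powV w p : 0 <= w -> (w^-1) `^ p = (w `^ p)^-1.
    by move=> w0; rewrite -(powR_inv1 w0) -(powR_inv1 (powR_ge0 w p)) powRAC.
  rewrite !powRM ?exprn_ge0 ?invr_ge0 ?(ltW x0) ?(ltW y0) ?(ltW A0) ?(ltW B0) //.
  rewrite !powX ?(ltW x0) ?(ltW y0) // !powV ?(ltW A0) ?(ltW B0) // /z /C exprMn.
  have Al : A `^ l != 0 by rewrite gt_eqF ?powR_gt0.
  have Bl : B `^ (1 - l) != 0 by rewrite gt_eqF ?powR_gt0.
  by rewrite le_eqVlt; apply/orP; left; apply/eqP; field; rewrite Al Bl.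
apply: limr_le => //; apply: nearW => n.
apply: (@le_trans _ _ (C * (l * (pseries c x n / A) + (1 - l) * (pseries c y n / B)))).
  rewrite /pseries /series /= !mulr_suml !mulr_sumr -big_split mulr_sumr /=.
  apply: ler_sum => i _.
  rewrite (_ : C * _ = c i * (C * (l * (x ^+ i / A) + (1 - l) * (y ^+ i / B)))).
    by rewrite ler_wpM2l.
  by ring.
apply: ler_piMr; first exact: ltW.
have a1 : pseries c x n / A <= 1 by rewrite ler_pdivrMr // mul1r.
have b1 : pseries c y n / B <= 1 by rewrite ler_pdivrMr // mul1r.
have : l * (pseries c x n / A) <= l * 1 by rewrite ler_wpM2l.
have : (1 - l) * (pseries c y n / B) <= (1 - l) * 1 by rewrite ler_wpM2l // subr_ge0.
lra.
Qed.

End NonnegPowerSeries.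

(** * Series in Gamma ratios *)

Definition gamma_ratio (R : realType) (a c t : R) : R := Gamma (a + t) / Gamma (c + t).

Lemma gamma_ratioP (R : realType) (a c : R) : 0 < a -> 0 < c ->
  gamma_ratio_rec a c (gamma_ratio a c).
Proof.
move=> a0 c0; split=> t t0; rewrite /gamma_ratio.
  by rewrite divr_gt0 // gamma_gt0 // ltr_wpDr.
have at0 : 0 < a + t by rewrite ltr_wpDr.
have ct0 : 0 < c + t by rewrite ltr_wpDr.
rewrite !addrA !gammaS //; field.
by rewrite (gt_eqF ct0) gt_eqF // gamma_gt0.
Qed.

Lemma gcoefE (R : realType) (g : nat -> R) (a c : R) :
  gcoef g a c = ratio_coef g (gamma_ratio a c).
Proof.
apply/funext => mu; apply/funext => n.
by rewrite /gcoef /ratio_coef /gamma_ratio !addrA.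
Qed.

Lemma admissible_gt0 (R : realType) (a c : R) (g : nat -> R) :
  admissible a c g -> [/\ 0 < a, 0 < c & forall n, 0 <= g n].
Proof. by case=> [[? ? ? ?]|[? ? [? _ _] _]]; split => //; lra. Qed.

Lemma gcoef_ge0 (R : realType) (g : nat -> R) (a c mu : R) n :
  admissible a c g -> 0 <= mu -> 0 <= gcoef g a c mu n.
Proof.
move=> /admissible_gt0 [a0 c0 g0] mu0.
rewrite gcoefE divr_ge0 // mulr_ge0 // ltW //.
by apply: (gamma_ratioP a0 c0).1; rewrite addr_ge0.
Qed.

Lemma gcoef_continuous (R : realType) (g : nat -> R) (a c mu : R) n :
    0 < a -> 0 < c -> 0 <= mu ->
  {for mu, continuous (fun mu => gcoef g a c mu n)}.
Proof.
move=> a0 c0 mu0.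
have arg_gt0 (s : R) : 0 < s -> 0 < s + n%:R + mu by move=> s0; rewrite !ltr_wpDr.
have Gs (s : R) : 0 < s -> {for mu, continuous (fun mu : R => Gamma (s + n%:R + mu))}.
  move=> s0; apply: (@continuous_comp _ _ _ (fun mu : R => s + n%:R + mu) (@Gamma R)).
    by apply: cvgD; [exact: cvg_cst | exact: cvg_id].
  by apply: continuous_Gamma; exact: arg_gt0.
apply: cvgM; last exact: cvg_cst.
apply: cvgM; first exact: cvg_cst.
apply: cvgM; first exact: Gs.
by apply: cvgV; [rewrite gt_eqF // gamma_gt0 // arg_gt0 | exact: Gs].
Qed.

Lemma gcoef_q_log_concave (R : realType) (g : nat -> R) (a c mu beta : R)
    (alpha n : nat) :
    admissible a c g -> 0 <= mu -> alpha%:R - 1 <= beta ->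
  pmul (gcoef g a c mu) (gcoef g a c (mu + alpha%:R + beta)) n
  <= pmul (gcoef g a c (mu + alpha%:R)) (gcoef g a c (mu + beta)) n.
Proof.
move=> hyp mu0 ab; have [a0 c0 _] := admissible_gt0 hyp.
rewrite gcoefE.
exact: (ratio_coef_q_log_concave_shift n hyp (gamma_ratioP a0 c0) mu0 ab).
Qed.

Lemma psum_pmul_le (R : realType) (f1 f2 h1 h2 : nat -> R) (x : R) :
    (forall n, 0 <= f1 n) -> (forall n, 0 <= f2 n) ->
    (forall n, 0 <= h1 n) -> (forall n, 0 <= h2 n) -> 0 <= x ->
    cvgn (pseries f1 x) -> cvgn (pseries f2 x) ->
    cvgn (pseries h1 x) -> cvgn (pseries h2 x) ->
    (forall n, pmul f1 f2 n <= pmul h1 h2 n) ->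
  psum f1 x * psum f2 x <= psum h1 x * psum h2 x.
Proof.
move=> f10 f20 h10 h20 x0 cf1 cf2 ch1 ch2 le.
have cf := cvg_pseries_pmul f10 f20 x0 cf1 cf2.
have ch := cvg_pseries_pmul h10 h20 x0 ch1 ch2.
rewrite -(cvg_lim _ cf) // -(cvg_lim _ ch) //.
apply: ler_lim; [exact: cvgP cf | exact: cvgP ch | apply: nearW => n].
by apply: ler_sum => i _; rewrite ler_wpM2r // exprn_ge0.
Qed.

Lemma psum_gt0 (R : realType) (f : nat -> R) (x : R) n :
  (forall k, 0 <= f k) -> 0 < x -> cvgn (pseries f x) -> 0 < f n -> 0 < psum f x.
Proof.
move=> f0 x0 cf fn; have := le_psum n.+1 f0 (ltW x0) cf.
apply: lt_le_trans; rewrite /pseries seriesSr ltr_wpDl //; last first.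
  by rewrite mulr_gt0 // exprn_gt0.
by apply: sumr_ge0 => k _; rewrite mulr_ge0 // exprn_ge0 // ltW.
Qed.

Lemma psum0 (R : realType) (f : nat -> R) (x : R) :
  (forall k, f k = 0) -> psum f x = 0.
Proof.
move=> f0; rewrite /psum (_ : pseries f x = fun=> 0) ?lim_cst //.
by apply/funext => n; rewrite /pseries /series /= big1 // => k _; rewrite f0 mul0r.
Qed.

(** The quotient F(s+1)/F(s) is nonincreasing along any real step, and
    F(mu+n)/F(mu) is a product of such quotients. *)
Lemma wright_of_unit_step (R : realType) (F : R -> R) :
    (forall s, 0 <= s -> 0 < F s) ->
    (forall s t, 0 <= s -> 0 <= t -> F s * F (s + 1 + t) <= F (s + 1) * F (s + t)) ->
  discrete_wright_log_concave F.
Proof.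
move=> F0 step; split=> [s s0|alpha mu beta _ mu0 be0]; first exact: ltW (F0 s s0).
elim: alpha => [|n IH]; first by rewrite addr0.
have n0 : 0 <= n%:R :> R by [].
rewrite -natr1 (addrA mu).
have := step (mu + n%:R) beta ltac:(lra) be0.
have p1 := F0 (mu + n%:R) ltac:(lra).
have p2 := F0 (mu + n%:R + beta) ltac:(lra).
have p3 := F0 (mu + beta) ltac:(lra).
move=> S; rewrite -(ler_pM2l (mulr_gt0 p1 p2)).
rewrite [leLHS](_ : _ = F (mu + n%:R) * F (mu + n%:R + 1 + beta)
  * (F mu * F (mu + n%:R + beta))); last by ring.
rewrite [leRHS](_ : _ = F (mu + n%:R + 1) * F (mu + n%:R + beta)
  * (F (mu + n%:R) * F (mu + beta))); last by ring.
apply: ler_pM => //; rewrite ltW // mulr_gt0 // F0 //; lra.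
Qed.

(** The two Cauchy products converge at every point of the set, the right end
    point included, since all the coefficients are nonnegative. *)
Lemma cvg_psi (R : realType) (g : nat -> R) (a c mu nu x : R) :
    admissible a c g -> 0 <= mu -> 0 <= nu ->
    pos_conv (gcoef g a c) [set 0; mu; nu; mu + nu] x ->
  pseries (psi_coef g a c mu nu) x @ \oo --> psi g a c mu nu x.
Proof.
move=> hyp mu0 nu0 [x0 cv].
have ge0 s : 0 <= s -> forall n, 0 <= gcoef g a c s n by move=> s0 n; exact: gcoef_ge0.
have c1 : cvgn (pseries (gcoef g a c 0) x) by apply: cv => /=; left; left; left.
have c2 : cvgn (pseries (gcoef g a c mu) x) by apply: cv => /=; left; left; right.
have c3 : cvgn (pseries (gcoef g a c nu) x) by apply: cv => /=; left; right.
have c4 : cvgn (pseries (gcoef g a c (mu + nu)) x) by apply: cv => /=; right.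
have -> : pseries (psi_coef g a c mu nu) x =
    pseries (pmul (gcoef g a c mu) (gcoef g a c nu)) x
    - pseries (pmul (gcoef g a c 0) (gcoef g a c (mu + nu))) x.
  apply/funext => n; rewrite /pseries /series /= fctE -sumrB.
  by apply: eq_bigr => i _; rewrite /psi_coef mulrBl.
apply: cvgB; apply: cvg_pseries_pmul => //; try exact: ltW.
all: by apply: ge0; rewrite ?addr_ge0.
Qed.

Lemma psi_coef_ge0 (R : realType) (g : nat -> R) (a c mu : R) (nu n : nat) :
    admissible a c g -> nu%:R - 1 <= mu ->
  0 <= psi_coef g a c mu nu%:R n.
Proof.
move=> hyp numu; rewrite subr_ge0 [leRHS]pmulC.
have := gcoef_q_log_concave n hyp (lexx 0) numu.
by rewrite !add0r (addrC nu%:R).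
Qed.

Lemma psi_nonneg_psum_on (R : realType) (g : nat -> R) (a c mu : R) (nu : nat) :
    admissible a c g -> (0 < nu)%N -> nu%:R - 1 <= mu ->
  nonneg_psum_on (pos_conv (gcoef g a c) [set 0; mu; nu%:R; mu + nu%:R])
    (psi_coef g a c mu nu%:R) (psi g a c mu nu%:R).
Proof.
move=> hyp nu0 numu.
have mu0 : 0 <= mu by apply: le_trans numu; rewrite subr_ge0 ler1n.
split=> [n|x Ix|x y [x0 cx] y0 yx].
- exact: psi_coef_ge0.
- have cP := cvg_psi hyp mu0 (ler0n _ nu) Ix.
  split; [exact: Ix.1 | exact: cvgP cP | by apply/esym; exact: cvg_lim cP].
- by split=> // m /cx; apply: cvg_pseries_le => //; exact: ltW.
Qed.

(** The induction in [wright_of_unit_step] divides by values of the sum, which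
    are positive unless g vanishes identically. *)
Lemma psum_gcoef_wright (R : realType) (g : nat -> R) (a c x : R) :
    admissible a c g -> pos_conv (gcoef g a c) `[0, +oo[ x ->
  discrete_wright_log_concave (fun mu => psum (gcoef g a c mu) x).
Proof.
move=> hyp [x0 cv].
have {}cv mu : 0 <= mu -> cvgn (pseries (gcoef g a c mu) x).
  by move=> mu0; apply: cv; rewrite /= in_itv /= mu0.
have ge0 s : 0 <= s -> forall n, 0 <= gcoef g a c s n by move=> s0 n; exact: gcoef_ge0.
have [a0 c0 g0] := admissible_gt0 hyp.
have [[n gn]|gz] := pselect (exists n, g n != 0); last first.
  have -> : (fun mu => psum (gcoef g a c mu) x) = fun=> 0.
    apply/funext => mu; apply: psum0 => n; rewrite /gcoef.
    have [->|gn] := eqVneq (g n) 0; first by rewrite !mul0r.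
    by case: gz; exists n.
  by split=> *; rewrite ?mulr0 lexx.
apply: wright_of_unit_step => [s s0|s t s0 t0].
  apply: (@psum_gt0 _ _ _ n) => //; [exact: ge0 | exact: cv |].
  rewrite gcoefE divr_gt0 ?ltr0n ?fact_gt0 // mulr_gt0 //.
    by rewrite lt_neqAle eq_sym gn g0.
  by apply: (gamma_ratioP a0 c0).1; rewrite addr_ge0.
have [s1 st s1t] : [/\ 0 <= s + 1, 0 <= s + t & 0 <= s + 1 + t] by split; lra.
apply: (psum_pmul_le (ge0 _ s0) (ge0 _ s1t) (ge0 _ s1) (ge0 _ st) (ltW x0)
  (cv _ s0) (cv _ s1t) (cv _ s1) (cv _ st)) => m.
have t0' : 1%:R - 1 <= t by rewrite subrr.
exact: (gcoef_q_log_concave m hyp s0 t0').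
Qed.

Theorem theorem4 (R : realType) (a c : R) (g : nat -> R) :
  [/\ a <= c + 1, c <= a, 0 < c & forall n, 0 <= g n] \/
  [/\ c + 1 < a, 1 < c + 1, log_concave g & no_internal_zeros g] ->
  [/\ forall x, pos_conv (gcoef g a c) `[0, +oo[ x ->
        discrete_wright_log_concave (fun mu => psum (gcoef g a c mu) x),
      discrete_q_log_concave (gcoef g a c) &
      forall (nu : nat) (mu : R), (0 < nu)%N -> nu%:R - 1 <= mu ->
        let I := pos_conv (gcoef g a c) [set 0; mu; nu%:R; mu + nu%:R] in
        [/\ forall n, 0 <= psi_coef g a c mu nu%:R n,
            absolutely_monotonic I (psi g a c mu nu%:R) &
            multiplicatively_convex I (psi g a c mu nu%:R)]].
Proof.
move=> hyp; have [a0 c0 _] := admissible_gt0 hyp.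
split=> [x|| nu mu nu0 numu I].
- exact: psum_gcoef_wright.
- split=> [mu n mu0|n|alpha mu beta _ ab mu0 n].
  + exact: gcoef_ge0.
  + apply: continuous_in_subspaceT => mu /set_mem /=; rewrite in_itv /= andbT => mu0.
    exact: gcoef_continuous.
  + by rewrite subr_ge0; exact: gcoef_q_log_concave.
- have H := psi_nonneg_psum_on hyp nu0 numu.
  split; first by case: H.
    exact: psum_absolutely_monotonic H.
  exact: psum_multiplicatively_convex H.
Qed.
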